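(* Let $G=(V,E)$ be a finite oriented graph and $k$ a positive integer, and let $\overline{\varphi}^{*}_G(k)$ denote the number of pairs $(f,\sigma)$ where $f$ is a $\mathbb{Z}_k$-flow on $G$ and $\sigma\subseteq E\setminus\operatorname{supp}(f)$ is a totally cyclic reorientation of $G_{/\operatorname{supp}(f)}$. Then: (1) if $E=\emptyset$, $\overline{\varphi}^{*}_G(k)=1$; (2) if $e\in E$ is a coloop, $\overline{\varphi}^{*}_G(k)=0$; (3) if $e\in E$ is a loop, $\overline{\varphi}^{*}_G(k)=(k+1)\,\overline{\varphi}^{*}_{G_{\setminus e}}(k)$; (4) if $e\in E$ is neither a loop nor a coloop, $\overline{\varphi}^{*}_G(k)=\overline{\varphi}^{*}_{G_{\setminus e}}(k)+\overline{\varphi}^{*}_{G_{/e}}(k)$.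
   Context: Oriented graphs may have loops and multiple edges. A $\mathbb{Z}_k$-flow is $f:E\to\mathbb{Z}_k$ such that at each vertex the sum of values on entering edges minus the sum on leaving edges is $0$; $\operatorname{supp}(f)=\{e:f(e)\neq0\}$. $G_{\setminus e}$ and $G_{/e}$ denote deletion and contraction of $e$; $G_{/S}$ contracts all edges of $S$. An edge $e$ is a coloop if $c(G_{\setminus e})=c(G)+1$, where $c$ counts weakly connected components. ${}_\sigma H$ is $H$ with the edges of $\sigma$ reversed; $\sigma$ is a totally cyclic reorientation of $H$ if every edge of ${}_\sigma H$ lies on a directed cycle (loops are directed cycles; the edgeless graph is totally cyclic). *)

(* Defs.v *)
From HB Require Import structures.
From mathcomp Require Import all_boot all_order all_algebra.

Set Implicit Arguments.
Unset Strict Implicit.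
Unset Printing Implicit Defensive.

Import GRing.Theory.

(* Loops and parallel edges are allowed: edges are abstract, with a source and
   a target. *)
Record ograph := OGraph {
  vertex : finType;
  edge : finType;
  src : edge -> vertex;
  tgt : edge -> vertex
}.

Arguments src {o} e.
Arguments tgt {o} e.

Section Ograph.

Variable G : ograph.
Implicit Types (e : edge G) (S : {set edge G}) (u v : vertex G).

Definition loop e : bool := src e == tgt e.

Definition adj S : rel (vertex G) :=
  [rel u v | [exists e in S, ((src e == u) && (tgt e == v))
                          || ((src e == v) && (tgt e == u))]].

Definition ncomponents : nat := n_comp (adj [set: edge G]) (vertex G).

Definition delete e : ograph :=
  @OGraph (vertex G) {x : edge G | x != e}
    (fun x => src (val x)) (fun x => tgt (val x)).

Definition merge_class S u : {set vertex G} := [set v | connect (adj S) u v].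

(* The vertices of the contraction are the vertex sets of the weakly connected
   components of the spanning subgraph (V, S). *)
Definition contract_vertex S : finType :=
  {A : {set vertex G} | A \in [set merge_class S u | u : vertex G]}.

Definition to_contract S u : contract_vertex S :=
  exist _ (merge_class S u) (imset_f (merge_class S) (erefl true : u \in vertex G)).

Definition contract S : ograph :=
  @OGraph (contract_vertex S) {x : edge G | x \notin S}
    (fun x => to_contract S (src (val x)))
    (fun x => to_contract S (tgt (val x))).

Definition reorient S : ograph :=
  @OGraph (vertex G) (edge G)
    (fun x => if x \in S then tgt x else src x)
    (fun x => if x \in S then src x else tgt x).

Definition dicycle (c : seq (edge G)) : bool :=
  [&& c != [::], cycle (fun x y => tgt x == src y) c & uniq (map src c)].

(* A directed cycle repeats no edge, so bounding its length by the number of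
   edges is no restriction, see totally_cyclicP. *)
Definition totally_cyclic : bool :=
  [forall e, exists n : 'I_#|edge G|.+1, exists c : n.-tuple (edge G),
     dicycle c && (e \in tval c)].

Lemma totally_cyclicP :
  reflect (forall e, exists c : seq (edge G), dicycle c /\ e \in c)
          totally_cyclic.
Proof.
apply: (iffP forallP) => [H e | H e].
  by have /existsP [n /existsP [c /andP [? ?]]] := H e; exists c.
have [c [dc ec]] := H e.
have uc : uniq c by case/and3P: dc => _ _ /map_uniq.
have sc : size c < #|edge G|.+1.
  by rewrite ltnS -(card_uniqP uc) max_card.
apply/existsP; exists (Ordinal sc); apply/existsP; exists (in_tuple c).
by rewrite dc ec.
Qed.

(* 'I_k.-1.+1 is the additive group Z/kZ for every k > 0; the type 'Z_k would
   denote Z/2Z when k = 1. *)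
Definition is_flow k (f : {ffun edge G -> 'I_k.-1.+1}) : bool :=
  [forall v, (\sum_(e | tgt e == v) f e - \sum_(e | src e == v) f e == 0)%R].

Definition supp k (f : {ffun edge G -> 'I_k.-1.+1}) : {set edge G} :=
  [set e | f e != 0%R].

End Ograph.

Definition coloop (G : ograph) (e : edge G) : bool :=
  ncomponents (delete e) == (ncomponents G).+1.

(* The set s of edges of G, read inside the contraction by S. *)
Definition contract_set (G : ograph) (S s : {set edge G}) :
    {set edge (contract S)} :=
  [set x : edge (contract S) | val x \in s].

Definition num_flow_reorient (G : ograph) (k : nat) : nat :=
  #|[set p : {ffun edge G -> 'I_k.-1.+1} * {set edge G} |
      [&& is_flow p.1, p.2 \subset ~: supp p.1
        & totally_cyclic (reorient (contract_set (supp p.1) p.2))]]|.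

(* Main.v *)
(* A graph is totally cyclic iff reachability along its arcs is symmetric, and
   contracting a set of edges amounts to making these edges undirected. Hence all
   pairs (f, sigma) for G, G\e and G/e can be read on the vertices of G, with e
   directed either way, absent, or undirected. Flows of G/e extend uniquely to e,
   so the pairs with f(e) <> 0 match those of G/e, and for a fixed f with
   f(e) = 0 and a fixed orientation of the other edges the claim becomes
     [e forward] + [e backward] = [e absent] + [e undirected],
   where the brackets are 1 or 0 according to total cyclicity. This holds as soon as
   the ends of e are connected in the rest of the graph. *)
Require Import Defs.
From mathcomp Require Import all_boot all_order all_algebra.

Set Implicit Arguments.
Unset Strict Implicit.
Unset Printing Implicit Defensive.

Import GRing.Theory.

(** * Relations with symmetric reachability *)

Section SymmetricConnect.

Variable T : finType.
Implicit Types (r : rel T) (x y a b : T).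

(** For the arcs of a graph this is total cyclicity: every weak component is strongly connected. *)
Definition csym r : bool := [forall x, forall y, connect r x y ==> connect r y x].

Lemma csymP r :
  reflect (forall x y, connect r x y -> connect r y x) (csym r).
Proof.
apply: (iffP forallP) => [H x y|H x]; first by move/(_ x)/forallP/(_ y)/implyP: H.
by apply/forallP => y; apply/implyP; apply: H.
Qed.

Lemma connect_stable r (A : pred T) : (forall x y, r x y -> A x -> A y) ->
  forall x y, connect r x y -> A x -> A y.
Proof.
move=> stA x y /connectP[p]; elim: p x => [|z p IHp] x /=; first by move=> _ ->.
by case/andP=> rxz rp yE Ax; apply: IHp rp yE (stA _ _ rxz Ax).
Qed.

Lemma csym_arcP r :
  reflect (forall x y, r x y -> connect r y x) (csym r).
Proof.
apply: (iffP (csymP r)) => [H x y /connect1/H //|H x y xy].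
apply: (connect_stable (A := connect r ^~ x)) xy (connect0 r x) => u v ruv.
exact/connect_trans/H.
Qed.

Lemma eq_csym r r' : connect r =2 connect r' -> csym r = csym r'.
Proof.
by move=> E; apply: eq_forallb => x; apply: eq_forallb => y; rewrite !E.
Qed.

Definition add_arc r a b : rel T := [rel x y | r x y || (x == a) && (y == b)].

Lemma connect_add_arcW r a b x y : connect r x y -> connect (add_arc r a b) x y.
Proof.
by apply: connect_sub x y => u v ruv; apply: connect1; rewrite /add_arc /= ruv.
Qed.

(** A path can be cut at its first visit to [a] and its last use of the new arc, so one use of that
    arc suffices. *)
Lemma connect_add_arc r a b x y : connect (add_arc r a b) x y =
  connect r x y || connect r x a && connect r b y.
Proof.
apply/idP/idP => [xy|].
  apply: (connect_stable (A := fun z => connect r x z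
      || connect r x a && connect r b z)) xy _; last by rewrite connect0.
  move=> u v /= /orP[ruv|/andP[/eqP-> /eqP->]]; last first.
    by case/orP=> [->|/andP[->]]; rewrite connect0 orbT.
  case/orP=> [xu|/andP[-> bu]]; first by rewrite (connect_trans xu (connect1 ruv)).
  by rewrite (connect_trans bu (connect1 ruv)) orbT.
case/orP=> [|/andP[xa by_]]; first exact: connect_add_arcW.
apply: connect_trans (connect_add_arcW a b xa) _.
apply: connect_trans (connect_add_arcW a b by_).
by apply: connect1; rewrite /add_arc /= !eqxx orbT.
Qed.

Lemma add_arc_redundant r a b :
  connect r a b -> connect (add_arc r a b) =2 connect r.
Proof.
move=> ab x y; rewrite connect_add_arc; case: (boolP (connect r x y)) => //= xy.
apply/negbTE; apply: contra xy => /andP[xa by_].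
exact: connect_trans xa (connect_trans ab by_).
Qed.

Lemma add_arcAC r a b c d :
  connect (add_arc (add_arc r a b) c d) =2 connect (add_arc (add_arc r c d) a b).
Proof. by apply: eq_connect => x y; rewrite /add_arc /= orbAC. Qed.

(** A path from [b] to [a] that uses the arc from [a] to [b] has already reached [a] before its
    first use. *)
Lemma csym_add_arc_back r a b : csym (add_arc r a b) -> connect r b a.
Proof.
move=> /csymP/(_ a b); rewrite !connect_add_arc !connect0 orbT => /(_ isT).
by case/orP=> // /andP[].
Qed.

(* If neither of [a], [b] reaches the other, the sets reachable from [a] and
   from [b] have an intersection and a union that are closed for [r] with both
   arcs added, hence unions of components; so the set reachable from [b], which
   misses [a], is closed for the undirected relation. *)
Lemma csym_add_both r r' a b : symmetric r' ->
  (forall x y, r' x y -> r x y || r y x) -> connect r' a b ->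
  csym (add_arc (add_arc r a b) b a) -> connect r a b || connect r b a.
Proof.
move=> sr' r'r r'ab /csymP cs; apply: contraT => /norP[nab nba].
have st (A : pred T) : (forall x y, r x y -> A x -> A y) -> A a = A b ->
    forall x y, r x y -> A y -> A x.
  move=> stA Aab x y rxy; apply: connect_stable (cs x y _); last first.
    by do 2!apply: connect_add_arcW; apply: connect1.
  move=> u v /orP[/orP[/stA//|]|] /andP[/eqP-> /eqP->]; first by rewrite Aab.
  by rewrite Aab.
have str c x y : r x y -> connect r c x -> connect r c y.
  by move=> rxy cx; apply: connect_trans cx (connect1 rxy).
have stI x y : r x y -> connect r a y && connect r b y -> connect r b x.
  move=> rxy H; suff /andP[//] : connect r a x && connect r b x.
  apply: (st (fun x => connect r a x && connect r b x)) rxy H => [u v ruv|].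
    by case/andP=> /(str _ _ _ ruv)-> /(str _ _ _ ruv)->.
  by rewrite (negbTE nab) (negbTE nba) andbF.
have stU x y : r x y -> connect r b y -> connect r a x || connect r b x.
  move=> rxy H; apply: (st (fun x => connect r a x || connect r b x)) rxy _.
  - by move=> u v ruv /orP[]/(str _ _ _ ruv)->; rewrite ?orbT.
  - by rewrite !connect0 orbT.
  - by rewrite H orbT.
(* If [r y x] with [x] reachable from [b], closure of the union puts [y] in one of the two reachable
   sets. If [a] reaches [y], it also reaches [x], so [x] is in the intersection, whose backward
   closure makes [y] reachable from [b]. *)
have stB x y : r' x y -> connect r b x -> connect r b y.
  move=> /r'r/orP[rxy|ryx] bx; first exact: str rxy bx.
  case/orP: (stU _ _ ryx bx) => // ay.
  by apply: (stI _ _ ryx); rewrite bx (str _ _ _ ryx ay).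
case/negP: nba; apply: (connect_stable stB) (connect0 r b).
by rewrite (sym_connect_sym sr').
Qed.

(** If [r] has symmetric reachability, [a] and [b] reach each other and all four terms are 1.
    Otherwise, if one of them reaches the other, the arc in that direction is redundant and the
    terms agree in pairs; if neither does, all four vanish. *)
Lemma csym_deletion_contraction r r' a b : symmetric r' ->
  (forall x y, r' x y -> r x y || r y x) -> connect r' a b ->
  csym (add_arc r a b) + csym (add_arc r b a) =
  csym r + csym (add_arc (add_arc r a b) b a).
Proof.
move=> sr' r'r r'ab; have [cs|ncs] := boolP (csym r).
  have ab : connect r a b.
    apply: (connect_sub _ r'ab) => u v /r'r/orP[/connect1//|/connect1].
    exact: csymP cs _ _.
  have ba : connect r b a by apply: csymP cs _ _ ab.
  rewrite (eq_csym (add_arcAC _ _ _ _ _)).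
  rewrite (eq_csym (add_arc_redundant (connect_add_arcW _ _ ab))).
  by rewrite !(eq_csym (add_arc_redundant _)) // cs.
have [ab|nab] := boolP (connect r a b).
  rewrite (eq_csym (add_arcAC _ _ _ _ _)).
  rewrite (eq_csym (add_arc_redundant (connect_add_arcW _ _ ab))).
  by rewrite (eq_csym (add_arc_redundant ab)) (negbTE ncs).
have [ba|nba] := boolP (connect r b a).
  rewrite (eq_csym (add_arc_redundant (connect_add_arcW _ _ ba))).
  by rewrite (eq_csym (add_arc_redundant ba)) (negbTE ncs) addnC.
rewrite (negbTE (contra (@csym_add_arc_back r a b) nba)).
rewrite (negbTE (contra (@csym_add_arc_back r b a) nab)).
rewrite (negbTE (contra (csym_add_both sr' r'r r'ab) _)) //.
by rewrite negb_or nab.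
Qed.

End SymmetricConnect.

(** * Reachability under identification of vertices *)

Section Quotient.

Variables (T T' : finType) (h : T -> T') (r : rel T) (r' : rel T').
Hypothesis h_surj : forall x', exists x, h x = x'.
Hypothesis h_arc : forall x y, r x y -> connect r' (h x) (h y).
Hypothesis h_lift :
  forall x' y', r' x' y' -> exists x y, [/\ h x = x', h y = y' & r x y].
Hypothesis h_ker : forall x y, h x = h y -> connect r x y.

Lemma connect_quotient x y : connect r' (h x) (h y) = connect r x y.
Proof.
apply/idP/idP => [xy|xy]; last first.
  apply: (connect_stable (A := fun z => connect r' (h x) (h z))) xy (connect0 _ _).
  by move=> u v /h_arc uv xu; apply: connect_trans xu uv.
(* The invariant must cover the whole fibre, since the next arc may lift to start at any vertex of
   it; [h_ker] moves within a fibre. *)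
suff : [forall z, (h z == h y) ==> connect r x z].
  by move/forallP/(_ y); rewrite eqxx.
apply: (connect_stable (A := fun z' => [forall z, (h z == z') ==> connect r x z])) xy _.
  move=> u' v' /h_lift[u [v [hu hv ruv]]] /forallP/(_ u); rewrite hu eqxx /= => xu.
  apply/forallP => z; apply/implyP=> /eqP hz; apply: connect_trans xu _.
  by apply: connect_trans (connect1 ruv) (h_ker _); rewrite hz.
by apply/forallP => z; apply/implyP => /eqP hz; apply: h_ker.
Qed.

Lemma csym_quotient : csym r' = csym r.
Proof.
apply/csymP/csymP => H x y.
  by rewrite -!connect_quotient; apply: H.
by have [[u <-] [v <-]] := (h_surj x, h_surj y); rewrite !connect_quotient; apply: H.
Qed.

End Quotient.

(** * Mixed graphs and total cyclicity as symmetric reachability *)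

Section Arcs.

Variable G : ograph.
Implicit Types (F B S s : {set edge G}) (u v : vertex G) (e x : edge G).

(* Edges of [F] are traversed from source to target, those of [B] backwards; an
   edge in both sets is undirected, which models its contraction. *)
Definition arcs F B : rel (vertex G) := [rel u v | [exists e,
  (e \in F) && (src e == u) && (tgt e == v)
  || (e \in B) && (tgt e == u) && (src e == v)]].

Lemma arcsP F B u v :
  reflect (exists e, [/\ e \in F, src e = u & tgt e = v]
                  \/ [/\ e \in B, tgt e = u & src e = v]) (arcs F B u v).
Proof.
apply: (iffP existsP) => -[e].
  by case/orP=> /andP[/andP[eI /eqP E1] /eqP E2]; exists e; [left|right].
by case=> -[eI E1 E2]; exists e; rewrite E1 E2 eI !eqxx ?orbT.
Qed.

Lemma arcs_fwd F B e : e \in F -> arcs F B (src e) (tgt e).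
Proof. by move=> eF; apply/arcsP; exists e; left. Qed.

Lemma arcs_bwd F B e : e \in B -> arcs F B (tgt e) (src e).
Proof. by move=> eB; apply/arcsP; exists e; right. Qed.

Lemma adjP S u v :
  reflect (exists2 e, e \in S & src e = u /\ tgt e = v \/ src e = v /\ tgt e = u)
          (adj S u v).
Proof.
apply: (iffP exists_inP) => -[e eS].
  by case/orP=> /andP[/eqP E1 /eqP E2]; exists e => //; [left|right].
by case=> -[E1 E2]; exists e; rewrite // E1 E2 !eqxx ?orbT.
Qed.

Lemma adj_sym S : symmetric (adj S).
Proof.
by move=> u v; apply/adjP/adjP => -[e eS [] [E1 E2]]; exists e => //; tauto.
Qed.

Lemma connect_adj_sym S : connect_sym (adj S).
Proof. exact/sym_connect_sym/adj_sym. Qed.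

Lemma eq_to_contract S u v :
  (to_contract S u == to_contract S v) = connect (adj S) u v.
Proof.
rewrite -val_eqE /=; apply/eqP/idP => [/setP/(_ v)|uv].
  by rewrite !inE connect0.
apply/setP=> w; rewrite !inE.
by rewrite (same_connect (@connect_adj_sym S) uv).
Qed.

Lemma to_contract_surj S (A : contract_vertex S) : exists u, to_contract S u = A.
Proof.
case: A => A AP; have /imsetP[u _ E] := AP.
by exists u; apply: val_inj; rewrite /= E.
Qed.

Lemma arcs_add_fwd F B e :
  arcs (e |: F) B =2 add_arc (arcs F B) (src e) (tgt e).
Proof.
move=> u v; apply/arcsP/orP => [[x [[/setU1P[->|xF] <- <-]|[xB <- <-]]]|].
- by right; rewrite !eqxx.
- by left; apply: arcs_fwd.
- by left; apply: arcs_bwd.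
case=> [/arcsP[x [[xF <- <-]|[xB <- <-]]]|/andP[/eqP-> /eqP->]].
- by exists x; left; rewrite setU1r.
- by exists x; right.
- by exists e; left; rewrite setU11.
Qed.

Lemma arcs_add_bwd F B e :
  arcs F (e |: B) =2 add_arc (arcs F B) (tgt e) (src e).
Proof.
move=> u v; apply/arcsP/orP => [[x [[xF <- <-]|[/setU1P[->|xB] <- <-]]]|].
- by left; apply: arcs_fwd.
- by right; rewrite !eqxx.
- by left; apply: arcs_bwd.
case=> [/arcsP[x [[xF <- <-]|[xB <- <-]]]|/andP[/eqP-> /eqP->]].
- by exists x; left.
- by exists x; right; rewrite setU1r.
- by exists e; right; rewrite setU11.
Qed.

(** Every edge other than [e] lies in [F] or [B], so adjacency off [e] can serve as the symmetric
    relation that joins the ends of [e]. *)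
Lemma csym_arcs_deletion_contraction F B e :
  connect (adj [set~ e]) (src e) (tgt e) -> ~: (F :|: B) = [set e] ->
  csym (arcs (e |: F) B) + csym (arcs F (e |: B)) =
  csym (arcs F B) + csym (arcs (e |: F) (e |: B)).
Proof.
move=> econ FB.
have adjFB u v : adj [set~ e] u v -> arcs F B u v || arcs F B v u.
  case/adjP=> x; rewrite -FB setCK => /setUP xFB.
  case: xFB => xI [] [<- <-]; apply/orP.
  - by left; apply: arcs_fwd.
  - by right; apply: arcs_fwd.
  - by right; apply: arcs_bwd.
  - by left; apply: arcs_bwd.
rewrite (eq_csym (eq_connect (arcs_add_fwd F B e))).
rewrite (eq_csym (eq_connect (arcs_add_bwd F B e))).
rewrite (csym_deletion_contraction (@adj_sym _) adjFB econ).
congr (_ + nat_of_bool _); apply: eq_csym; apply: eq_connect => u v.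
by rewrite arcs_add_bwd /add_arc /= arcs_add_fwd.
Qed.

Definition link : rel (edge G) := fun x y => tgt x == src y.

Lemma link_connect x y (c : seq (edge G)) : path link x (rcons c y) ->
  connect (arcs setT set0) (tgt x) (src y).
Proof.
elim: c x => [|z c IHc] x /=; first by rewrite andbT => /eqP->.
case/andP=> /eqP-> /IHc; apply: connect_trans.
by apply/connect1/arcs_fwd; rewrite inE.
Qed.

Lemma arcs_link x (p : seq (vertex G)) : path (arcs setT set0) (tgt x) p ->
  exists c, [/\ path link x c, map src c = belast (tgt x) p
              & tgt (last x c) = last (tgt x) p].
Proof.
elim: p x => [|v p IHp] x /=; first by exists [::].
case/andP=> /arcsP[y [[_ sy ty]|[]]]; last by rewrite inE.
rewrite -ty => /IHp[c [lc sc tc]]; exists (y :: c) => /=.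
by rewrite lc sc sy /link sy eqxx.
Qed.

(** A directed cycle through [e] amounts to a directed path from the target of [e] back to its
    source. *)
Lemma totally_cyclic_csym : totally_cyclic G = csym (arcs setT set0).
Proof.
apply/totally_cyclicP/csym_arcP => [H u v|H e].
  case/arcsP=> e [[_ <- <-]|[]]; last by rewrite inE.
  have [c [/and3P[_ cc _] ec]] := H e.
  have [i c' Ec] := rot_to ec; move: cc; rewrite -(rot_cycle i) Ec /=.
  exact: link_connect.
have := H _ _ (@arcs_fwd setT set0 e (in_setT e)).
(* Shortening removes repeated vertices; the vertices of the path are the sources of the edges of
   the cycle, which are therefore distinct. *)
case/connectP=> p0 p0P; case/shortenP: p0P => p pP up _ eE.
have [c [lc sc tc]] := arcs_link pP.
exists (e :: c); split; last exact: mem_head.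
apply/and3P; split=> //; first by rewrite /= rcons_path lc /= /link tc -eE.
by move: up; rewrite lastI -eE rcons_uniq /= sc.
Qed.

End Arcs.

(** The contraction identifies exactly the vertices joined by edges of [S], and these reach each
    other once [S] is undirected; so [csym_quotient] applies. *)
Lemma totally_cyclic_contract (G : ograph) (S s : {set edge G}) :
  totally_cyclic (reorient (contract_set S s)) = csym (arcs (S :|: ~: s) (S :|: s)).
Proof.
rewrite totally_cyclic_csym.
apply: (@csym_quotient _ _ (to_contract S)) => [A|u v|A B|u v].
- exact: to_contract_surj.
- have SE x : x \in S -> to_contract S (src x) = to_contract S (tgt x).
    move=> xS; apply/eqP; rewrite eq_to_contract; apply: connect1.
    by apply/adjP; exists x; [|left].
  case/arcsP=> x [[xI <- <-]|[xI <- <-]]; have [/SE->|xS] := boolP (x \in S);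
    rewrite ?connect0 //; apply: connect1; apply/arcsP;
    exists (exist _ x xS : edge (reorient (contract_set S s))); left;
    move: xI; rewrite !inE (negbTE xS) /= => xI; split=> //=;
    by rewrite inE /= ?xI ?(negbTE xI).
- case/arcsP=> -[x xS] [[_ <- <-]|[]]; last by rewrite inE.
  rewrite /= inE /=; case: ifP => xs.
    exists (tgt x), (src x); split=> //; apply: arcs_bwd; by rewrite !inE xs orbT.
  exists (src x), (tgt x); split=> //; apply: arcs_fwd; by rewrite !inE xs orbT.
- move/eqP; rewrite eq_to_contract; apply: connect_sub => {u v} u v.
  case/adjP=> x xS [] [<- <-]; apply: connect1.
    by apply: arcs_fwd; rewrite inE xS.
  by apply: arcs_bwd; rewrite inE xS.
Qed.

(** * Coloops as edges whose ends are disconnected by deletion *)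

Section Coloop.

Variables (G : ograph) (e : edge G).

Lemma adj_delete : adj [set: edge (delete e)] =2 adj [set~ e].
Proof.
move=> u v; apply/adjP/adjP => [[[x xe] _ E]|[x]].
  by exists x; rewrite ?inE.
by rewrite !inE => xe E; exists (exist _ x xe : edge (delete e)).
Qed.

Lemma connect_adjT : connect (adj [set: edge G]) =2
  connect (add_arc (add_arc (adj [set~ e]) (src e) (tgt e)) (tgt e) (src e)).
Proof.
apply: eq_connect => u v; rewrite /add_arc /=; apply/adjP/idP => [[x _ E]|].
  have [xe|xe] := eqVneq x e.
    by subst x; case: E => -[<- <-]; rewrite !eqxx ?orbT.
  by apply/orP; left; apply/orP; left; apply/adjP; exists x; rewrite ?inE.
case/orP=> [/orP[/adjP[x _ E]|]|]; first by exists x.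
  by case/andP=> /eqP-> /eqP->; exists e => //; left.
by case/andP=> /eqP-> /eqP->; exists e => //; right.
Qed.

(** If the ends stay connected off [e], the components do not change; otherwise [e] merges exactly
    two of them. *)
Lemma coloopE : coloop e = ~~ connect (adj [set~ e]) (src e) (tgt e).
Proof.
rewrite /coloop /ncomponents (eq_n_comp (eq_connect adj_delete)) /=.
set r := adj _; set a := src e; set b := tgt e.
have rC : connect_sym r := @connect_adj_sym _ _.
have [ab|nab] /= := boolP (connect r a b).
  have ba : connect r b a by rewrite rC.
  suff E : connect (adj setT) =2 connect r.
    by rewrite (eq_n_comp E); apply/negbTE; rewrite neq_ltn ltnSn.
  move=> x y; rewrite connect_adjT (add_arc_redundant (connect_add_arcW _ _ ba)).
  exact: add_arc_redundant.
have CE x : (x \in closure r (pred2 a b)) = connect r x a || connect r x b.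
  apply/idP/idP => [/pred0Pn[y /=]|].
    by rewrite !inE => /andP[xy /orP[]/eqP<-]; rewrite xy ?orbT.
  by case/orP=> xy; apply/pred0Pn; [exists a|exists b]; rewrite /= !inE xy eqxx ?orbT.
have CE1 x : (x \in closure r (pred2 a b)) = (x \in connect (adj setT) a).
  rewrite CE [RHS]connect_adjT !connect_add_arc !connect0.
  by rewrite (rC x a) (rC x b) orbT /= orbb.
(* The closure of the two ends counts for two components without [e] and one with it. Outside it
   reachability is the same for both relations, hence so are the roots. *)
rewrite (n_compC (closure r (pred2 a b))) n_comp_closure2 // nab.
rewrite (n_compC (closure r (pred2 a b)) (adj setT)) (eq_n_comp_r CE1).
rewrite n_comp_connect; last exact: connect_adj_sym.
rewrite -addSn eqn_add2l; apply/eqP/eq_card => x.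
rewrite !inE; case: (boolP (x \in _)); rewrite ?andbF //= !andbT => xC.
rewrite /roots /fingraph.root (@eq_pick _ _ (connect (adj setT) x)) // => y.
move: xC; rewrite CE connect_adjT !connect_add_arc => /norP[/negbTE-> /negbTE->].
by rewrite /= !orbF.
Qed.

End Coloop.

(** * Net flow through a cut *)

Section NetFlow.

Local Open Scope ring_scope.

Variables (G : ograph) (Z : zmodType).
Implicit Types (f : edge G -> Z).

Definition net f v : Z := \sum_(x | tgt x == v) f x - \sum_(x | src x == v) f x.

Lemma sum_net f (A : pred (vertex G)) : \sum_(v | A v) net f v =
  \sum_(x | A (tgt x)) f x - \sum_(x | A (src x)) f x.
Proof.
rewrite /net sumrB (partition_big (@tgt G) A) // (partition_big (@src G) A) //.
by congr (_ - _); apply: eq_bigr => v Av; apply: eq_bigl => x;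
  case: eqP => [->|]; rewrite ?Av ?andbT ?andbF.
Qed.

(** The vertices joined to the source of [e] off [e] form a cut crossed by [e] alone, so their net
    values add up to [- f e]. *)
Lemma coloop_flow0 f (e : edge G) :
  coloop e -> (forall v, net f v = 0) -> f e = 0.
Proof.
rewrite coloopE => nab f0; pose A := connect (adj [set~ e]) (src e).
have := sum_net f A; rewrite big1 //.
rewrite (bigID (pred1 e)) big1 /=; last first.
  by move=> x /andP[Ax /eqP E]; rewrite /A E (negbTE nab) in Ax.
rewrite add0r [X in _ - X](bigD1 e) /=; last exact: connect0.
rewrite (eq_bigl (fun x => A (src x) && (x != e))) => [/eqP|x].
  by rewrite opprD addrCA subrr addr0 eq_sym oppr_eq0 => /eqP.
have [->|xe] := eqVneq x e; rewrite ?andbF ?andbT //.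
apply: (same_connect_r (@connect_adj_sym _ _)); apply: connect1.
by apply/adjP; exists x; rewrite ?inE //; right.
Qed.

End NetFlow.

(** * Functions and sets on an edge set with one edge removed *)

Section Restriction.

Variables (E : finType) (e : E) (P : pred E).
(** [P] stays abstract because deletion and contraction express being different from [e] by
    different predicates. *)
Hypothesis PE : forall x, P x = (x != e).
Notation E' := {x : E | P x}.

Section Functions.

Variable Z : finType.
Implicit Types (p : {ffun E -> Z} * {set E}) (q : {ffun E' -> Z} * {set E'}).

Definition restr_fun (f : {ffun E -> Z}) : {ffun E' -> Z} := [ffun x => f (val x)].
Definition restr_set (s : {set E}) : {set E'} := [set x | val x \in s].
Definition restr p := (restr_fun p.1, restr_set p.2).

(** The value at [e] may depend on the restriction: it is a constant for deletion and the balancing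
    value for contraction. *)
Definition extend (c : {ffun E' -> Z} -> Z) (b : bool) q :
    {ffun E -> Z} * {set E} :=
  ([ffun x => if insub x is Some y then q.1 y else c q.1],
   [set x | if insub x is Some y then y \in q.2 else b]).

Lemma insub_removed : (insub e : option E') = None.
Proof. by apply: insubF; rewrite PE eqxx. Qed.

Lemma extendK c b : cancel (extend c b) restr.
Proof.
case=> f s; congr (_, _) => /=.
  by apply/ffunP=> x; rewrite !ffunE valK.
by apply/setP=> x; rewrite !inE valK.
Qed.

Lemma restrK c b p : p.1 e = c (restr_fun p.1) -> (e \in p.2) = b ->
  extend c b (restr p) = p.
Proof.
case: p => f s /= fe se; congr (_, _).
  apply/ffunP=> x; rewrite !ffunE; case: insubP => [y _ yx|]; first by rewrite ffunE yx.
  by rewrite PE negbK => /eqP->.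
apply/setP=> x; rewrite !inE; case: insubP => [y _ yx|]; first by rewrite inE yx.
by rewrite PE negbK => /eqP->.
Qed.

(** With the data at [e] prescribed, [restr] and [extend] are inverse bijections. This turns counts
    for a minor into counts of pairs on [G]. *)
Lemma card_restr c b (Q : pred ({ffun E' -> Z} * {set E'})) :
  #|[set p : {ffun E -> Z} * {set E} |
     [&& p.1 e == c (restr_fun p.1), (e \in p.2) == b & Q (restr p)]]|
  = #|[set q | Q q]|.
Proof.
rewrite -[RHS](card_imset _ (can_inj (extendK c b))); congr #|pred_of_set _|.
apply/setP=> p; rewrite inE; apply/and3P/imsetP => [[/eqP fe /eqP se Qp]|[q]].
  by exists (restr p); rewrite ?inE // restrK.
rewrite inE => Qq ->; rewrite extendK Qq; split=> //.
  have -> : restr_fun (extend c b q).1 = q.1.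
    by rewrite -[RHS](congr1 fst (extendK c b q)).
  by rewrite ffunE insub_removed.
by rewrite inE insub_removed.
Qed.

End Functions.

Lemma restr_setU s t : restr_set (s :|: t) = restr_set s :|: restr_set t.
Proof. by apply/setP=> x; rewrite !inE. Qed.

Lemma restr_setC s : restr_set (~: s) = ~: restr_set s.
Proof. by apply/setP=> x; rewrite !inE. Qed.

Lemma restr_subset (s t : {set E}) : (s \subset t) =
  (restr_set s \subset restr_set t) && ((e \in s) ==> (e \in t)).
Proof.
apply/subsetP/andP => [st|[/subsetP st /implyP est] x xs].
  by split; [apply/subsetP => x; rewrite !inE; apply: st|apply/implyP/st].
have [xe|xe] := eqVneq x e; first by rewrite xe in xs *; apply: est.
rewrite -PE in xe.
by have := st (exist _ x xe); rewrite !inE /=; apply.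
Qed.

Lemma sum_restr (Z : finZmodType) (f : {ffun E -> Z}) (Q : pred E) :
  (\sum_(x | Q x) f x = \sum_(y : E' | Q (val y)) restr_fun f y
     + (if Q e then f e else 0))%R.
Proof.
rewrite (bigID P) /=; congr (_ + _)%R.
  rewrite (@reindex_omap _ _ _ _ _ (val : E' -> E) insub) => [|x /andP[_ Px]];
    last by rewrite insubT.
  apply: eq_big => [y|y _]; last by rewrite ffunE.
  by rewrite valK eqxx (valP y) !andbT.
rewrite (eq_bigl (fun x => (x == e) && Q x)) => [|x]; last by rewrite PE negbK andbC.
by rewrite big_mkcondr big_pred1_eq.
Qed.

End Restriction.

(** * Flows and reachability in the deletion and the contraction of one edge *)

Section DeletionContraction.

Variables (G : ograph) (e : edge G) (k : nat).
Notation Z := 'I_k.-1.+1.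
Notation Pdel := (fun x : edge G => x != e).
Notation Pcon := (fun x : edge G => x \notin [set e]).
Implicit Types (f : {ffun edge G -> Z}) (s F B : {set edge G}).

Lemma PdelE x : Pdel x = (x != e).
Proof. by []. Qed.

Lemma PconE x : Pcon x = (x != e).
Proof. by rewrite /= inE. Qed.

Lemma is_flowP (H : ograph) (g : {ffun edge H -> Z}) :
  reflect (forall v, net g v = 0%R) (is_flow g).
Proof. exact: 'forall_eqP. Qed.

Lemma net_delete f v : (net f v =
  net (restr_fun Pdel f : {ffun edge (delete e) -> Z}) v
  + ((if tgt e == v then f e else 0) - (if src e == v then f e else 0)))%R.
Proof.
rewrite /net (sum_restr PdelE f (fun x => tgt x == v)).
by rewrite (sum_restr PdelE f (fun x => src x == v)) opprD addrACA.
Qed.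

Lemma is_flow_delete f : loop e || (f e == 0%R) ->
  is_flow (restr_fun Pdel f : {ffun edge (delete e) -> Z}) = is_flow f.
Proof.
move=> H; apply: eq_forallb => v; congr (_ == _).
rewrite -[RHS]/(net f v) net_delete; case/orP: H => /eqP->.
  by rewrite subrr addr0.
by rewrite !if_same subrr addr0.
Qed.

Lemma to_contract_edge :
  to_contract [set e] (src e) = to_contract [set e] (tgt e).
Proof.
apply/eqP; rewrite eq_to_contract; apply: connect1.
by apply/adjP; exists e; rewrite ?inE //; left.
Qed.

(** Both ends of [e] lie in the same class, so the value at [e] cancels in the sum over each
    class. *)
Lemma net_contract f A :
  net (restr_fun Pcon f : {ffun edge (contract [set e]) -> Z}) A =
  (\sum_(v | to_contract [set e] v == A) net f v)%R.
Proof.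
rewrite sum_net (sum_restr PconE f (fun x => to_contract [set e] (tgt x) == A)).
rewrite (sum_restr PconE f (fun x => to_contract [set e] (src x) == A)).
by rewrite to_contract_edge opprD addrACA subrr addr0.
Qed.

Lemma connect_adj1 u v : connect (adj [set e]) u v ->
  (v == u) || (u \in [:: src e; tgt e]) && (v \in [:: src e; tgt e]).
Proof.
move=> uv; apply: (connect_stable (A := fun v => (v == u)
  || (u \in [:: src e; tgt e]) && (v \in [:: src e; tgt e]))) uv _;
  last by rewrite eqxx.
move=> x y /adjP[z]; rewrite inE => /eqP-> E.
have [xI yI] : x \in [:: src e; tgt e] /\ y \in [:: src e; tgt e].
  by case: E => -[<- <-]; rewrite !inE !eqxx ?orbT.
by case/orP=> [/eqP<-|/andP[-> _]]; rewrite ?xI yI orbT.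
Qed.

(* The unique value at [e] that balances a flow of the contraction at the target
   of [e]; balance at the source is then automatic. *)
Definition lift_value (g : {ffun {x | Pcon x} -> Z}) : Z :=
  (\sum_(x | src (val x) == tgt e) g x - \sum_(x | tgt (val x) == tgt e) g x)%R.

(** The first condition is balance at the target of [e]. Every class other than that of the two ends
    is a single vertex, and in that class balance at the target leaves balance at the source. *)
Lemma is_flow_contract f : ~~ loop e ->
  is_flow f = (f e == lift_value (restr_fun Pcon f))
    && is_flow (restr_fun Pcon f : {ffun edge (contract [set e]) -> Z}).
Proof.
rewrite /loop => nl.
have fe : (f e == lift_value (restr_fun Pcon f)) = (net f (tgt e) == 0%R).
  rewrite /net (sum_restr PconE f (fun x => tgt x == tgt e)).
  rewrite (sum_restr PconE f (fun x => src x == tgt e)).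
  rewrite eqxx (negbTE nl) addr0 -[LHS]subr_eq0 /lift_value opprB.
  by rewrite [(f e + _)%R]addrC addrAC.
rewrite fe; apply/is_flowP/andP => [f0|[/eqP fb /is_flowP f0] v].
  split; first by rewrite f0.
  by apply/is_flowP => A; rewrite net_contract big1.
have [->//|vb] := eqVneq v (tgt e).
have := f0 (to_contract [set e] v); rewrite net_contract (bigD1 v) //=.
rewrite big1 ?addr0 // => w /andP[]; rewrite eq_to_contract => /connect_adj1.
rewrite eq_sym => /orP[/eqP->|]; first by rewrite eqxx.
rewrite !inE (negbTE vb) orbF => /andP[/orP[]/eqP-> /eqP->]; last by [].
by rewrite eqxx.
Qed.

Lemma csym_arcs_delete F B :
  csym (@arcs (delete e) (restr_set Pdel F) (restr_set Pdel B)) =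
  csym (arcs (F :\ e) (B :\ e)).
Proof.
apply: eq_csym; apply: eq_connect => u v; apply/arcsP/arcsP => [[[x xe]]|[x]].
  by rewrite !inE /= => H; exists x; rewrite !inE xe.
rewrite !inE => H; have xe : x != e by case: H => -[/andP[]].
by exists (exist _ x xe : edge (delete e)); rewrite !inE /=; rewrite xe in H.
Qed.

Lemma csym_arcs_contract F B :
  csym (@arcs (contract [set e]) (restr_set Pcon F) (restr_set Pcon B)) =
  csym (arcs (e |: F) (e |: B)).
Proof.
apply: (@csym_quotient _ _ (to_contract [set e])) => [A|u v|A1 A2|u v].
- exact: to_contract_surj.
- case/arcsP=> x [] [/setU1P[->|xI] <- <-]; rewrite ?to_contract_edge ?connect0 //;
  have [->|xe] := eqVneq x e; rewrite ?to_contract_edge ?connect0 //;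
  rewrite -PconE in xe; apply/connect1/arcsP;
  exists (exist _ x xe : edge (contract [set e])); rewrite !inE; by [left|right].
- by case/arcsP=> -[x xe] [] [xI <- <-]; rewrite inE /= in xI;
  [exists (src x), (tgt x)|exists (tgt x), (src x)]; split=> //;
  [apply: arcs_fwd|apply: arcs_bwd]; rewrite setU1r.
- move/eqP; rewrite eq_to_contract; apply: connect_sub => {u v} u v.
  case/adjP=> x; rewrite inE => /eqP-> [] [<- <-]; apply: connect1.
    by apply: arcs_fwd; rewrite setU11.
  by apply: arcs_bwd; rewrite setU11.
Qed.

Lemma csym_arcs_loop F B :
  loop e -> csym (arcs (F :\ e) (B :\ e)) = csym (arcs F B).
Proof.
move=> /eqP le; apply: eq_csym => u v; apply/idP/idP; apply: connect_sub => {u v} u v.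
  by case/arcsP=> x [] [/setD1P[_ xI] <- <-]; apply: connect1;
    [apply: arcs_fwd|apply: arcs_bwd].
case/arcsP=> x [] [xI <- <-]; have [->|xe] := eqVneq x e; rewrite ?le ?connect0 //;
  by apply: connect1; (apply: arcs_fwd || apply: arcs_bwd); rewrite !inE xe.
Qed.

End DeletionContraction.

(** * Counting the pairs *)

Definition flow_reorientation (H : ograph) (k : nat)
    (p : {ffun edge H -> 'I_k.-1.+1} * {set edge H}) : bool :=
  [&& is_flow p.1, p.2 \subset ~: supp p.1
    & csym (arcs (supp p.1 :|: ~: p.2) (supp p.1 :|: p.2))].

Lemma num_flow_reorientE (H : ograph) k :
  num_flow_reorient H k = #|[set p | @flow_reorientation H k p]|.
Proof.
by apply: eq_card => p; rewrite !inE /flow_reorientation totally_cyclic_contract.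
Qed.

Section Count.

Variables (G : ograph) (e : edge G) (k : nat).
Notation Z := 'I_k.-1.+1.
Notation Pdel := (fun x : edge G => x != e).
Notation Pcon := (fun x : edge G => x \notin [set e]).
Implicit Types (f : {ffun edge G -> Z}) (s F B : {set edge G}).

Lemma flow_reorientation_delete f s : loop e || (f e == 0%R) ->
  @flow_reorientation (delete e) k (restr Pdel (f, s)) =
  [&& is_flow f, restr_set Pdel s \subset restr_set Pdel (~: supp f)
    & csym (arcs ((supp f :|: ~: s) :\ e) ((supp f :|: s) :\ e))].
Proof.
move=> H; rewrite /flow_reorientation /= is_flow_delete //.
have -> : @supp (delete e) k (restr_fun Pdel f) = restr_set Pdel (supp f).
  by apply/setP=> x; rewrite !inE ffunE.
by rewrite -csym_arcs_delete !restr_setU !restr_setC.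
Qed.

Lemma flow_reorientation_contract f s :
  @flow_reorientation (contract [set e]) k (restr Pcon (f, s)) =
  [&& is_flow (restr_fun Pcon f : {ffun edge (contract [set e]) -> Z}),
      restr_set Pcon s \subset restr_set Pcon (~: supp f)
    & csym (arcs (e |: (supp f :|: ~: s)) (e |: (supp f :|: s)))].
Proof.
rewrite /flow_reorientation /=.
have -> : @supp (contract [set e]) k (restr_fun Pcon f) = restr_set Pcon (supp f).
  by apply/setP=> x; rewrite !inE ffunE.
by rewrite -csym_arcs_contract !restr_setU !restr_setC.
Qed.

(** A flow vanishes on [e], so [e] is directed one way only; total cyclicity would give a return
    path avoiding [e], which joins its ends in the deletion. *)
Lemma num_flow_reorient_coloop : coloop e -> num_flow_reorient G k = 0.
Proof.
move=> ce; rewrite num_flow_reorientE; apply/eqP; rewrite cards_eq0.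
apply/eqP/setP => -[f s]; rewrite !inE; apply/and3P => -[/= /is_flowP f0 _].
have {f0} fe := coloop_flow0 ce f0; rewrite coloopE in ce.
set F := _ :|: _; set B := _ :|: _.
have eF : (e \in F) = (e \notin s) by rewrite !inE fe eqxx.
have eB : (e \in B) = (e \in s) by rewrite !inE fe eqxx.
have nF (F' B' : {set edge G}) : e \notin F' -> e \notin B' ->
    connect (arcs F' B') (tgt e) (src e) || connect (arcs F' B') (src e) (tgt e) ->
    connect (adj [set~ e]) (src e) (tgt e).
  move=> eF' eB'.
  have sub : subrel (arcs F' B') (connect (adj [set~ e])).
    move=> u v /arcsP[x H]; apply/connect1/adjP; exists x.
      by rewrite !inE; apply: contraNneq eF' => xe;
        case: H => -[]; rewrite xe // (negbTE eB').
    by case: H => -[_ <- <-]; [left|right].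
  by case/orP=> /(connect_sub sub) //; rewrite connect_adj_sym.
move=> cs; case/negP: ce; have [es|es] := boolP (e \in s).
  apply: (nF F (B :\ e)); rewrite ?eF ?es ?inE ?eqxx //.
  apply/orP; right; apply: csym_add_arc_back.
  by rewrite -(eq_csym (eq_connect (arcs_add_bwd _ _ _))) setD1K ?eB.
apply: (nF (F :\ e) B); rewrite ?eB ?inE ?eqxx //.
apply/orP; left; apply: csym_add_arc_back.
by rewrite -(eq_csym (eq_connect (arcs_add_fwd _ _ _))) setD1K ?eF.
Qed.

(** A loop affects neither balance nor reachability. Each pair of the deletion extends in [k] ways
    with [e] outside the set, and in one way with [e] inside, where the value must be 0. *)
Lemma num_flow_reorient_loop : 0 < k -> loop e ->
  num_flow_reorient G k = (k + 1) * num_flow_reorient (delete e) k.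
Proof.
move=> k0 le; rewrite !num_flow_reorientE.
have frE p : flow_reorientation p = @flow_reorientation (delete e) k (restr Pdel p)
    && ((e \in p.2) ==> (p.1 e == 0%R)).
  case: p => f s; rewrite flow_reorientation_delete ?le // csym_arcs_loop //.
  rewrite /flow_reorientation /=.
  rewrite (restr_subset (@PdelE _ e)) !inE negbK.
  by case: (is_flow f); case: (_ \subset _); case: csym; rewrite ?andbT ?andbF.
have fiber (z : Z) b : b ==> (z == 0%R) ->
    #|[set p | flow_reorientation p & (p.1 e == z) && ((e \in p.2) == b)]| =
    #|[set q | @flow_reorientation (delete e) k q]|.
  move=> bz; rewrite -(card_restr (@PdelE _ e) (fun=> z) b).
  apply: eq_card => p; rewrite !inE frE andbC -!andbA.
  case: eqP => //= pz; case: eqP => //= pb; rewrite pz pb bz andbT //.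
rewrite -(cardsID [set p : {ffun edge G -> Z} * {set edge G} | e \in p.2]).
rewrite mulnDl mul1n addnC; congr (_ + _); last first.
  rewrite -(fiber 0%R true) //; apply: eq_card => p; rewrite !inE frE.
  by case: (e \in p.2); rewrite /= ?andbF ?andbT //; case: eqP; rewrite ?andbT ?andbF.
rewrite -sum1_card.
rewrite (partition_big (fun p : {ffun edge G -> Z} * {set edge G} => p.1 e) predT) //=.
rewrite (eq_bigr (fun=> #|[set q | @flow_reorientation (delete e) k q]|)) => [|z _].
  (* The value type has [k.-1.+1] elements, which is [k] because [k] is positive. *)
  by rewrite sum_nat_const card_ord; congr (_ * _); exact: prednK.
rewrite sum1dep_card -(fiber z false) //; apply: eq_card => p; rewrite !inE.
by case: (e \in p.2); rewrite ?andbF ?andbT.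
Qed.

(* Summing over [e \notin s], the four terms of the identity for fixed [f] with
   [f e = 0] count the two orientations of [e], its deletion and its contraction. *)
Lemma num_flow_reorient_ordinary : ~~ loop e -> ~~ coloop e ->
  num_flow_reorient G k =
    num_flow_reorient (delete e) k + num_flow_reorient (contract [set e]) k.
Proof.
move=> nl; rewrite coloopE negbK => econ; rewrite !num_flow_reorientE.
rewrite -(card_restr (@PdelE _ e) (fun=> 0%R) false).
rewrite -(card_restr (@PconE _ e) (@lift_value G e k) false).
(* Toggling [e] reverses that edge; it carries the pairs with [e] in the set to pairs without it,
   where all counts are compared term by term. *)
pose tog (p : {ffun edge G -> Z} * {set edge G}) :=
  (p.1, if e \in p.2 then p.2 :\ e else e |: p.2).
have togK : involutive tog.
  case=> f s; rewrite /tog /=; congr (_, _); case es: (e \in s).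
    by rewrite !inE eqxx /= setD1K.
  by rewrite setU11 setU1K ?es.
rewrite -(cardsID [set p : {ffun edge G -> Z} * {set edge G} | e \in p.2]).
rewrite -(card_imset _ (inv_inj togK)) addnC.
rewrite -!sum1_card big_mkcond [X in _ + X]big_mkcond -big_split /=.
rewrite [X in X + _]big_mkcond [X in _ + X]big_mkcond -big_split /=.
apply: eq_bigr => -[f s] _.
have togE (A : {set {ffun edge G -> Z} * {set edge G}}) :
    ((f, s) \in tog @: A) = (tog (f, s) \in A).
  by rewrite -{1}[(f, s)]togK mem_imset //; apply: inv_inj.
rewrite togE !inE {togE togK} /= flow_reorientation_contract /tog /= setDE.
case: (boolP (e \in s)) => es /=; rewrite ?(setD11, inE, eqxx, andbF) //=.
have subE (P : pred (edge G)) : (forall x, P x = (x != e)) ->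
    (restr_set P s \subset restr_set P (~: supp f)) = (s \subset ~: supp f).
  by move=> PE; rewrite [RHS](restr_subset PE) (negbTE es) andbT.
rewrite [X in _ = _ + X](_ : _ = nat_of_bool [&& is_flow f, s \subset ~: supp f
      & csym (arcs (e |: (supp f :|: ~: s)) (e |: (supp f :|: s)))]); last first.
  by rewrite (is_flow_contract f nl) (subE _ (@PconE _ e)) -andbA; case: ifP.
(* If [f e] is nonzero, the toggled pair and the deletion term are excluded, and [e] is already
   undirected, so the pair counts equally for [G] and the contraction. *)
rewrite andbT; have [fe|fe] /= := eqVneq (f e) 0%R; last first.
  have eU t : e |: (supp f :|: t) = supp f :|: t.
    by apply/setUidPr; rewrite sub1set !inE fe.
  by rewrite /flow_reorientation /= !eU subUset sub1set !inE fe andbF addn0 add0n; case: ifP.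
have fe0 : loop e || (f e == 0%R) by rewrite fe eqxx orbT.
rewrite (flow_reorientation_delete s fe0) (subE _ (@PdelE _ e)).
rewrite /flow_reorientation /= subUset sub1set !inE fe eqxx /=.
case: (is_flow f) => /=; last by [].
case: (s \subset _) => /=; last by [].
have eF : e \in supp f :|: ~: s by rewrite !inE es orbT.
have eB : e \notin supp f :|: s by rewrite !inE fe eqxx.
have -> : supp f :|: ~: (e |: s) = (supp f :|: ~: s) :\ e.
  by apply/setP => x; rewrite !inE; have [->|] := eqVneq x e; rewrite ?fe ?eqxx.
have -> : e |: (supp f :|: ~: s) = supp f :|: ~: s.
  by apply/setUidPr; rewrite sub1set.
rewrite setUCA.
have -> : (supp f :|: s) :\ e = supp f :|: s.
  by apply/setP => x; rewrite in_setD1; have [->|//] := eqVneq x e; rewrite (negbTE eB).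
(* With [f e] zero, removing [e] from the forward set leaves the two sets covering exactly the edges
   other than [e]. *)
have := @csym_arcs_deletion_contraction _ ((supp f :|: ~: s) :\ e) (supp f :|: s)
  _ econ.
rewrite (setD1K eF) => ->; first by [].
apply/setP => x; rewrite !inE; have [->|_] := eqVneq x e.
  by rewrite fe eqxx (negbTE es).
by case: (x \in s); rewrite ?orbT ?orbF.
Qed.

End Count.

(** * The edgeless case and the four rules together *)

Lemma num_flow_reorient_edgeless (G : ograph) k :
  #|edge G| = 0 -> num_flow_reorient G k = 1.
Proof.
move=> E0; have noE (x : edge G) : False by have /card0_eq/(_ x) := E0.
rewrite num_flow_reorientE (_ : [set p | _] = setT).
  rewrite cardsT card_prod card_ffun E0 expn0 mul1n.
  by rewrite -cardsT -powersetT card_powerset cardsT E0.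
apply/setP=> -[f s]; rewrite !inE; apply/and3P; split=> /=.
- by apply/is_flowP => v; rewrite /net !big1 ?subrr // => x; case: (noE x).
- by apply/subsetP => x; case: (noE x).
- by apply/csym_arcP => u v /arcsP[x]; case: (noE x).
Qed.

Theorem theoremA1 (G : ograph) (k : nat) (k_gt0 : 0 < k) :
  [/\ #|edge G| = 0 -> num_flow_reorient G k = 1,
      forall e : edge G, coloop e -> num_flow_reorient G k = 0,
      forall e : edge G, loop e ->
        num_flow_reorient G k = (k + 1) * num_flow_reorient (delete e) k
    & forall e : edge G, ~~ loop e -> ~~ coloop e ->
        num_flow_reorient G k =
          num_flow_reorient (delete e) k
          + num_flow_reorient (contract [set e]) k].

Proof.
split.
- exact: num_flow_reorient_edgeless.
- by move=> e; apply: num_flow_reorient_coloop.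
- by move=> e; apply: num_flow_reorient_loop.
- by move=> e; apply: num_flow_reorient_ordinary.
Qed.
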